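(* Let $u:\mathbb{R}^n\to\mathbb{R}$ be a convex entire subsolution of $$\sum_{i,j}a_{ij}(x,u,\nabla u,\nabla^2u,\nabla^3u)\,\Delta u_{x_ix_j}-F(x,u,\nabla u,\nabla^2u,\nabla^3u)=0,$$ that is, $\sum_{i,j}a_{ij}\,\Delta u_{x_ix_j}\ge F$ in $\mathbb{R}^n$, such that $u\in C^4(\mathbb{R}^n)\cap L^\infty(\mathbb{R}^n)$, $\nabla^3u\in C^\alpha_{loc}(\mathbb{R}^n)$ for some $\alpha\in(0,1)$, and there exists $C>0$ such that $|\nabla^lu|\le C$ for $l=1,2,3$. Assume that, for constants $0<\lambda\le\Lambda$, $$\lambda|\xi|^2\le\sum_{i,j}a_{ij}(x,u,\nabla u,\nabla^2u,\nabla^3u)\,\xi_i\xi_j\le\Lambda|\xi|^2\qquad\text{for all }x,\xi\in\mathbb{R}^n,$$ and that $F\ge0$. Then $u$ is constant.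
   Context: $a_{ij}$ and $F$ are real valued functions of the indicated arguments, and $\Delta u_{x_ix_j}=\partial_{x_i}\partial_{x_j}\Delta u$. *)

(* Defs.v *)
From mathcomp Require Export all_boot all_order all_algebra.
From mathcomp Require Export all_classical all_reals all_analysis.
Export Order.TTheory GRing.Theory Num.Theory.
Export numFieldNormedType.Exports.
Set Implicit Arguments.
Unset Strict Implicit.
Unset Printing Implicit Defensive.
Local Open Scope classical_set_scope.
Local Open Scope ring_scope.

(* The library norm on matrices is the sup norm, hence this Euclidean one. *)
Definition enorm (R : realType) (n : nat) (x : 'rV[R]_n) : R :=
  Num.sqrt (\sum_i x 0 i ^+ 2).

(* Tensors of order l over R^n, given by their entries. *)
Definition tensor (R : realType) (n l : nat) := {ffun l.-tuple 'I_n -> R}.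

Definition tnorm (R : realType) (n l : nat) (T : tensor R n l) : R :=
  Num.sqrt (\sum_t T t ^+ 2).

Definition partial (R : realType) (n : nat) (i : 'I_n) (u : 'rV[R]_n -> R)
    : 'rV[R]_n -> R :=
  fun x => 'D_('e_i) u x.

(* partials [:: i1; ...; il] u = d_{i1} (... (d_{il} u)) *)
Definition partials (R : realType) (n : nat) (s : seq 'I_n)
    (u : 'rV[R]_n -> R) : 'rV[R]_n -> R :=
  foldr (@partial R n) u s.

(* 'D_v is a total operator, so the existence of the partial derivatives is
   required explicitly. *)
Definition classC (R : realType) (n k : nat) (u : 'rV[R]_n -> R) : Prop :=
  forall s : seq 'I_n, (size s <= k)%N ->
    continuous (partials s u) /\
    ((size s < k)%N -> forall (i : 'I_n) x, derivable (partials s u) x 'e_i).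

Definition nabla (R : realType) (n l : nat) (u : 'rV[R]_n -> R)
    (x : 'rV[R]_n) : tensor R n l :=
  [ffun t : l.-tuple 'I_n => partials t u x].

Definition laplacian (R : realType) (n : nat) (u : 'rV[R]_n -> R)
    : 'rV[R]_n -> R :=
  fun x => \sum_(i < n) partial i (partial i u) x.

Definition holder_loc (R : realType) (n l : nat) (alpha : R)
    (T : 'rV[R]_n -> tensor R n l) : Prop :=
  forall K : set 'rV[R]_n, compact K -> exists M : R,
    forall x y, K x -> K y ->
      tnorm (T x - T y) <= M * enorm (x - y) `^ alpha.

(* n-dimensional Lebesgue measure zero, via countable covers by closed boxes
   of arbitrarily small total volume. *)
Definition lebesgue_null (R : realType) (n : nat) (A : set 'rV[R]_n) : Prop :=
  forall e : R, 0 < e -> exists a b : nat -> 'rV[R]_n,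
    [/\ forall k i, a k 0 i <= b k 0 i,
        A `<=` \bigcup_k [set x | forall i, a k 0 i <= x 0 i <= b k 0 i] &
        (\sum_(0 <= k <oo) (\prod_(i < n) (b k 0 i - a k 0 i))%:E < e%:E)%E].

(* Essential boundedness; measurability is not included, as this is only
   applied to continuous functions. *)
Definition ess_bounded (R : realType) (n : nat) (u : 'rV[R]_n -> R) : Prop :=
  exists M : R, lebesgue_null [set x | M < `|u x|].

(* A function of (x, u, Du, D^2u, D^3u). *)
Definition jet_fun (R : realType) (n : nat) (V : Type) : Type :=
  'rV[R]_n -> R -> tensor R n 1 -> tensor R n 2 -> tensor R n 3 -> V.

Definition along (R : realType) (n : nat) (V : Type) (G : jet_fun R n V)
    (u : 'rV[R]_n -> R) (x : 'rV[R]_n) : V :=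
  G x (u x) (nabla 1 u x) (nabla 2 u x) (nabla 3 u x).

Definition subsolution (R : realType) (n : nat) (a : jet_fun R n 'M[R]_n)
    (F : jet_fun R n R) (u : 'rV[R]_n -> R) : Prop :=
  forall x, along F u x <=
    \sum_(i < n) \sum_(j < n)
      along a u x i j * partial i (partial j (laplacian u)) x.

(* Main.v *)
Require Import Defs.
From mathcomp Require Import measurable_realfun.
Set Implicit Arguments.
Unset Strict Implicit.
Unset Printing Implicit Defensive.
Local Open Scope classical_set_scope.
Local Open Scope ring_scope.

(** A convex function on a vector space that is bounded above is constant: if
    [u y > u x], then [u] grows at least linearly along the ray issued from [x]
    through [y] ([convex_bounded_above_le]).

    The bound at hand only holds off a Lebesgue-null set, so it has to be turned
    into a bound everywhere ([ess_bounded_bounded]).  If [`|u| > M] at one point,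
    then by continuity [`|u| > M] on a closed cube of positive volume, and such a
    cube is not null: the volume of a box is at most the total volume of any
    countable family of boxes covering it ([box_volume_le_cover]).  This is the
    only measure-theoretic fact needed in dimension [n]; it is proved by
    integrating out one coordinate at a time, which reduces it to exchanging a
    nonnegative series with the Lebesgue integral on the line. *)

Lemma lebesgue_measure_segment (R : realType) (a b : R) : a <= b ->
  lebesgue_measure (`[a, b]%classic : set R) = (b - a)%:E.
Proof.
rewrite le_eqVlt => /predU1P[->|ab]; rewrite lebesgue_measure_itv /= lte_fin.
  by rewrite ltxx subrr.
by rewrite ab.
Qed.

(** The weights [c] are what makes the induction on the list [s] of coordinates
    go through: freezing the first coordinate at [t] discards the boxes whose
    first side misses [t], which amounts to multiplying [c k] by an indicator.
    Integrating the inequality obtained for the remaining coordinates over [t]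
    turns these indicators into the lengths of the first sides. *)
Lemma box_volume_le_weighted (R : realType) (I : eqType) (s : seq I)
    (A B : I -> R) (a b : nat -> I -> R) (c : nat -> R) :
  uniq s -> (forall i, A i <= B i) -> (forall k i, a k i <= b k i) ->
  (forall k, 0 <= c k) ->
  (forall x : I -> R, (forall i, A i <= x i <= B i) ->
    (1 <= \sum_(0 <= k <oo)
       (c k * \prod_(i <- s) \1_(`[a k i, b k i]%classic) (x i))%:E)%E) ->
  ((\prod_(i <- s) (B i - A i))%:E <=
     \sum_(0 <= k <oo) (c k * \prod_(i <- s) (b k i - a k i))%:E)%E.
Proof.
move=> + AB ab; elim: s c => [|j s IHs] c /=.
  move=> _ c0 /(_ A); rewrite big_nil => H.
  have /H : forall i, A i <= A i <= B i by move=> i; rewrite lexx AB.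
  under eq_eseriesr do rewrite big_nil.
  by under [X in _ -> (_ <= X)%E]eq_eseriesr do rewrite big_nil.
move=> /andP[js us] c0 cover.
pose V k := \prod_(i <- s) (b k i - a k i).
have V0 k : 0 <= V k by apply: prodr_ge0 => i _; rewrite subr_ge0.
pose S k : set R := `[a k j, b k j]%classic.
have mS k : measurable (S k) by exact: measurable_itv.
pose D : set R := `[A j, B j]%classic.
have mD : measurable D by exact: measurable_itv.
have slice t : D t -> ((\prod_(i <- s) (B i - A i))%:E <=
    \sum_(0 <= k <oo) ((c k * V k)%:E * (\1_(S k) t)%:E))%E.
  rewrite /D /= in_itv /= => tD.
  under eq_eseriesr do rewrite -EFinM mulrAC.
  apply: IHs => // [k|x xAB]; first by rewrite mulr_ge0// indicE.
  pose y i := if i == j then t else x i.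
  have /cover : forall i, A i <= y i <= B i.
    by move=> i; rewrite /y; case: eqP => [->|].
  congr (_ <= _)%E; apply: eq_eseriesr => k _.
  rewrite big_cons {1}/y eqxx mulrA; congr (_ * _)%:E.
  apply: eq_big_seq => i si; rewrite /y ifN//.
  by apply: contraNneq js => <-.
have -> : ((\prod_(i <- j :: s) (B i - A i))%:E =
    \int[lebesgue_measure]_(t in D) (\prod_(i <- s) (B i - A i))%:E)%E.
  rewrite integral_cst// big_cons EFinM.
  by rewrite -(lebesgue_measure_segment (AB j)) muleC.
have mi k : measurable_fun D (fun t => (\1_(S k) t)%:E)%E.
  by apply/measurable_EFinP; exact: measurable_indic.
have ms k : measurable_fun D
    (fun t => (c k * V k)%:E * (\1_(S k) t)%:E)%E by exact: measurable_funeM.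
have s0 k t : (0 <= (c k * V k)%:E * (\1_(S k) t)%:E)%E.
  by rewrite -EFinM lee_fin !mulr_ge0// indicE.
apply: (@le_trans _ _ (\int[lebesgue_measure]_(t in D)
    \sum_(0 <= k <oo) ((c k * V k)%:E * (\1_(S k) t)%:E))%E).
  apply: ge0_le_integral => //.
  - by move=> t _; rewrite lee_fin prodr_ge0// => i _; rewrite subr_ge0.
  - exact: (@ge0_emeasurable_sum _ _ _ _ _ xpredT (fun k t _ _ => s0 k t)).
rewrite integral_nneseries//.
apply: lee_nneseries => [k _ _|k _].
  by apply: integral_ge0 => t _; exact: s0.
rewrite ge0_integralZl_EFin ?mulr_ge0//; last exact: mi.
rewrite integral_indic//; last exact: mS.
rewrite big_cons mulrCA [X in (_ <= X%:E)%E]mulrC !EFinM.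
apply: lee_wpmul2l; first by rewrite -EFinM lee_fin mulr_ge0.
rewrite -(lebesgue_measure_segment (ab k j)).
by apply: le_measure; rewrite ?inE//; exact: (measurableI _ _ (mS k) mD).
Qed.

Lemma box_volume_le_cover (R : realType) (I : finType)
    (A B : I -> R) (a b : nat -> I -> R) :
  (forall i, A i <= B i) -> (forall k i, a k i <= b k i) ->
  (forall x : I -> R, (forall i, A i <= x i <= B i) ->
    exists k, forall i, a k i <= x i <= b k i) ->
  ((\prod_i (B i - A i))%:E <=
     \sum_(0 <= k <oo) (\prod_i (b k i - a k i))%:E)%E.
Proof.
move=> AB ab cover.
under eq_eseriesr do rewrite -[\prod_i _]mul1r.
apply: box_volume_le_weighted => //; first exact: index_enum_uniq.
move=> x /cover[k xk].
have s0 m :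
    (0 <= (1 * \prod_i \1_(`[a m i, b m i]%classic) (x i))%:E :> \bar R)%E.
  by rewrite mul1r lee_fin prodr_ge0// => i _; rewrite indicE.
apply: le_trans (nneseries_lim_ge k.+1 (fun m _ _ => s0 m)).
rewrite big_nat_recr//= -[leLHS]add0e leeD//; first exact: sume_ge0.
rewrite mul1r big1// => i _; rewrite indicE mem_set//=.
by rewrite in_itv /= xk.
Qed.

Lemma lebesgue_null_interior (R : realType) (n : nat) (A : set 'rV[R]_n) :
  lebesgue_null A -> interior A = set0.
Proof.
move=> Anull; apply/seteqP; split=> // p /nbhs_ballP[e /= e0 pA].
pose d := e / 2.
have d0 : 0 < d by rewrite divr_gt0.
have [//|a [b [ab Acover]]] :=
  Anull (\prod_(i < n) ((p 0 i + d) - (p 0 i - d))).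
  by apply: prodr_gt0 => i _; rewrite subr_gt0 ltrD2l gtrN.
apply/negP; rewrite -leNgt.
apply: box_volume_le_cover => [i|k i|x xp].
- by rewrite lerD2l ge0_cp// ltW.
- exact: ab.
have /Acover[k _ xk] : A (\row_i x i).
  apply: pA; split=> // i j; rewrite ord1 mxE /ball /= distrC.
  apply: (@le_lt_trans _ _ d); first by rewrite ler_distl.
  by rewrite /d ltr_pdivrMr// ltr_pMr// ltr1n.
by exists k => i; have := xk i; rewrite mxE.
Qed.

Lemma ess_bounded_bounded (R : realType) (n : nat) (u : 'rV[R]_n -> R) :
  continuous u -> ess_bounded u -> exists M, forall x, u x <= M.
Proof.
move=> cu [M /lebesgue_null_interior uM]; exists M => x.
rewrite leNgt; apply/negP => Mx.
suff : set0 x by [].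
rewrite -uM; have : \forall y \near x, M < u y by exact: (cvgr_gt _ (cu x)).
by apply: filterS => y /= /lt_le_trans; apply; exact: ler_norm.
Qed.

(** With [z = x + N (y - x)], the point [y] divides the segment from [x] to [z]
    in the ratio [1 : N - 1], so convexity gives
    [u z >= u x + N (u y - u x)], which exceeds [M] for [N] large. *)
Lemma convex_bounded_above_le (R : realType) (E : lmodType R) (u : E -> R)
    (M : R) :
  convex_function [set: convex_lmodType E] u -> (forall x, u x <= M) ->
  forall x y, u y <= u x.
Proof.
move=> cvx uM x y; rewrite leNgt; apply/negP => uxy.
pose d := u y - u x.
have d0 : 0 < d by rewrite subr_gt0.
(* chosen so that the lower bound [u x + N * d] on [u z] equals [M + d] *)
pose N := 1 + (M - u x) / d.
have N1 : 1 <= N by rewrite lerDl divr_ge0 ?subr_ge0// ltW.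
have N0 : 0 < N by exact: lt_le_trans N1.
have Ni0 : 0 <= N^-1 by rewrite invr_ge0 ltW.
have Ni1 : N^-1 <= 1 by rewrite invf_le1.
pose z : E := x + N *: (y - x).
have yzx : N^-1 *: z + (1 - N^-1) *: x = y.
  rewrite scalerDr scalerA mulVf ?gt_eqF// scale1r scalerBl scale1r.
  by rewrite addrC addrA subrK subrKC.
have uy : u y <= N^-1 * u z + (1 - N^-1) * u x.
  rewrite -{1}yzx.
  exact: (cvx (Itv01 Ni0 Ni1) z x (mem_set I) (mem_set I)).
have : N * d <= u z - u x.
  rewrite mulrC -ler_pdivlMr// mulrC mulrBr lerBlDr.
  by apply: le_trans uy _; rewrite mulrBl mul1r addrA addrAC.
rewrite mulrDl mul1r divfK ?gt_eqF// addrA lerD2r leNgt.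
by rewrite (le_lt_trans (uM z))// ltrDr.
Qed.

Theorem corollary6p8 (R : realType) (n : nat)
    (a : jet_fun R n 'M[R]_n) (F : jet_fun R n R)
    (u : 'rV[R]_n -> R) (alpha C lambda Lambda : R)
    (u_convex : convex_function [set: convex_lmodType 'rV[R]_n] u)
    (u_sub : subsolution a F u)
    (u_C4 : classC 4 u)
    (u_Linfty : ess_bounded u)
    (alpha_in01 : 0 < alpha < 1)
    (u_C3alpha : holder_loc alpha (nabla 3 u))
    (C_gt0 : 0 < C)
    (u_bound : forall (l : nat) (x : 'rV[R]_n), (1 <= l <= 3)%N ->
       tnorm (nabla l u x) <= C)
    (lambda_gt0 : 0 < lambda) (lambda_le : lambda <= Lambda)
    (a_elliptic : forall x xi : 'rV[R]_n,
       lambda * enorm xi ^+ 2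
         <= \sum_(i < n) \sum_(j < n) along a u x i j * xi 0 i * xi 0 j
         <= Lambda * enorm xi ^+ 2)
    (F_ge0 : forall x z p H T, 0 <= F x z p H T) :
  exists c : R, forall x : 'rV[R]_n, u x = c.
Proof.
have [M uM] := ess_bounded_bounded (u_C4 [::] isT).1 u_Linfty.
exists (u 0) => x; apply/eqP; rewrite eq_le.
by rewrite !(convex_bounded_above_le u_convex uM).
Qed.
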